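(* Fix $\theta\in\Theta$. The dual of the conic linear program (CLP) defined in the context can be written as the following semi-infinite program: $$ \text{(CLP-D)}\qquad \begin{array}{cll} \min_{v\in\mathbb{R}^{m+1}} & \displaystyle\frac1m\sum_{i=1}^m v_i+r_0\, v_{m+1} & \\ \text{s.t.} & h(\theta,s)-v_i-v_{m+1}\, d(s,\xi^i)\le 0, & s\in\Xi,\ i\in[m],\\ & v_1,\dots,v_m\in\mathbb{R},\quad v_{m+1}\ge 0. & \end{array} $$ Furthermore, strong duality holds, i.e. the optimal values of (CLP) and (CLP-D) are equal. Additionally, for $r_0>0$, the optimal solutions of (CLP-D) are contained in the polytope $$\mathcal{H}:=\Big\{v\in\mathbb{R}^{m+1}:\ C_1\le v_i\le (m+1)C_2-mC_1\ \text{for } i\in[m],\quad 0\le v_{m+1}\le (C_2-C_1)/r_0\Big\},$$ where $C_1$ and $C_2$ are lower and upper bounds of $h(\cdot,\cdot)$ on $\Theta\times\Xi$, respectively.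
   Context: Setting. $[m]=\{1,\dots,m\}$. $(\Xi,\mathcal{F})$ is a measurable space, where $\Xi\subseteq\mathbb{R}^n$ and $\mathcal{F}$ is a $\sigma$-algebra containing all singletons of $\Xi$. $d(\cdot,\cdot)$ is a metric on $\Xi$, measurable with respect to $\mathcal{F}\times\mathcal{F}$. The points $\xi^1,\dots,\xi^m\in\Xi$ are observed samples; $\Xi$ is partitioned as $\Xi=\bigcup_{i=1}^{m+1}\Xi^i$ with $\Xi^i=\{\xi^i\}$ for $i\in[m]$ and $\Xi^{m+1}=\Xi\setminus\bigcup_{i\in[m]}\Xi^i$. Standing assumptions: $r_0>0$ is a scalar; $\Theta\subseteq\mathbb{R}^n$ and $\Xi$ are compact; $h:\Theta\times\Xi\to\mathbb{R}$ is continuous in $\theta$ and bounded on $\Theta\times\Xi$; for every $\theta\in\Theta$ there exists $C(\theta)>0$ with $|h(\theta,s_1)-h(\theta,s_2)|\le C(\theta)\,d(s_1,s_2)$ for all $s_1,s_2\in\Xi$. The problem (CLP), for fixed $\theta$, is the following, over positive measures $\mu$ on $(\Xi\times\Xi,\mathcal{F}\times\mathcal{F})$ (denoted $\mu\succeq0$): $$ \begin{array}{cll} \sup_{\mu} & \displaystyle\int_{s\in\Xi} h(\theta,s)\,\mu(ds\times\Xi) & \\ \text{s.t.} & \mu(\Xi\times\Xi^i)=1/m, & i\in[m],\\ & \mu(\Xi\times\Xi^{m+1})=0, & \\ & \displaystyle\sum_{i\in[m]}\int_{s\in\Xi} d(s,\xi^i)\,\mu(ds\times\Xi^i)\le r_0,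 & \\ & \mu\succeq 0. & \end{array} $$ Meaning of ''dual''. Let $\mathcal{X}$ be the space of finite signed measures on $(\Xi\times\Xi,\mathcal{F}\times\mathcal{F})$, $\mathcal{X}^+=\{\mu\in\mathcal{X}:\mu\succeq0\}$, $\mathcal{X}'$ the set of functions $f:\Xi\times\Xi\to\mathbb{R}$ that are $\mu$-integrable for all $\mu\in\mathcal{X}^+$, and $\langle\mu,f\rangle=\int f\,d\mu$. Let $\psi_0(s_1,s_2)=h(\theta,s_1)$; $\psi_j(s_1,s_2)=\mathbf{1}_{\Xi^j}(s_2)$ for $j\in[m+1]$; $\psi_{m+2}(s_1,s_2)=\sum_{i=1}^m d(s_1,s_2)\mathbf{1}_{\Xi^i}(s_2)$. Let $\mathcal{A}\mu=(\langle\mu,\psi_1\rangle,\dots,\langle\mu,\psi_{m+2}\rangle)^T$, $b=(1/m,\dots,1/m,0,r_0)^T\in\mathbb{R}^{m+2}$ and $\mathcal{K}=\{0\}^{m+1}\times(-\infty,0]$. Then (CLP) is $\sup\{\langle\mu,\psi_0\rangle:\mathcal{A}\mu-b\in\mathcal{K},\ \mu\in\mathcal{X}^+\}$, and its conic dual is $\inf\{-b^Tw:\ \mathcal{A}^*w+\psi_0\in-(\mathcal{X}^+)^*,\ w\in\mathcal{K}^*\}$, where $\mathcal{A}^*w=\sum_{j=1}^{m+2}w_j\psi_j$, $\mathcal{K}^*=\mathbb{R}^{m+1}\times(-\infty,0]$, and $-(\mathcal{X}^+)^*=\{f\in\mathcal{X}':\langle\mu,f\rangle\le0\ \forall\mu\succeq0\}$.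 The correspondence of variables between this dual and (CLP-D) is $v_i=-w_i$ for $i\in[m]$ and $v_{m+1}=-w_{m+2}$; the variable $w_{m+1}$, which does not occur in the objective, is eliminated.
   Formalization: Two implicit assumptions are made explicit: h(θ,·) is measurable (needed for the integral in (CLP)), and, only for identifying the conic dual with (CLP-D), ψ_{m+2} is integrable for every finite measure (it lies in X'), since a measurable metric d on Ξ may be unbounded. *)

(* Defs.v *)
From HB Require Import structures.
From mathcomp Require Import all_boot all_order all_algebra.
From mathcomp Require Import all_classical all_reals all_analysis measurable_realfun.

Set Implicit Arguments.
Unset Strict Implicit.
Unset Printing Implicit Defensive.

Import Order.TTheory GRing.Theory Num.Theory.
Import numFieldNormedType.Exports.

Local Open Scope classical_set_scope.
Local Open Scope ring_scope.

Definition is_metric (R : realType) (T : Type) (d : T -> T -> R) : Prop :=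
  [/\ forall x y, 0 <= d x y,
      forall x y, d x y = 0 <-> x = y,
      forall x y, d x y = d y x
    & forall x y z, d x z <= d x y + d y z].

Section ConicProgram.
Context {dO : measure_display} {O : measurableType dO} {R : realType}.
Context (N : nat).

(* The sup/inf pair below is
     sup <mu, psi0>  s.t.  A mu - b \in K,  mu >= 0,
     inf - b^T w     s.t.  A^* w + psi0 \in -(X^+)^*,  w \in K^*,
   where X^+ is the cone of finite positive measures. [integrable_all] is the
   space X' paired with the finite signed measures, and [neg_polar] is
   -(X^+)^*, which is by definition a subset of X'. *)
Definition integrable_all (f : O -> R) : Prop :=
  forall mu : {finite_measure set O -> \bar R},
    mu.-integrable [set: O] (EFin \o f).

Definition pairing (mu : {finite_measure set O -> \bar R}) (f : O -> R) : R :=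
  \int[mu]_x f x.

Definition neg_polar (f : O -> R) : Prop :=
  integrable_all f /\
  forall mu : {finite_measure set O -> \bar R}, pairing mu f <= 0.

Definition dotp (x y : 'rV[R]_N) : R := \sum_(j < N) x ord0 j * y ord0 j.

Definition dual_cone (K : set 'rV[R]_N) : set 'rV[R]_N :=
  [set w | forall x, K x -> 0 <= dotp x w].

Context (psi0 : O -> R) (psi : 'I_N -> O -> R)
  (b : 'rV[R]_N) (K : set 'rV[R]_N).

Definition conic_map (mu : {finite_measure set O -> \bar R}) : 'rV[R]_N :=
  \row_j pairing mu (psi j).

Definition conic_adjoint (w : 'rV[R]_N) : O -> R :=
  fun x => \sum_(j < N) w ord0 j * psi j x.

Definition conic_feasible : set {finite_measure set O -> \bar R} :=
  [set mu | K (conic_map mu - b)].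

Definition conic_value : \bar R :=
  ereal_sup [set (pairing mu psi0)%:E | mu in conic_feasible].

Definition conic_dual_feasible : set 'rV[R]_N :=
  [set w | neg_polar (fun x => conic_adjoint w x + psi0 x) /\ dual_cone K w].

Definition conic_dual_objective (w : 'rV[R]_N) : R := - dotp b w.

End ConicProgram.

Section WassersteinProgram.
Context {dT : measure_display} {T : measurableType dT} {R : realType}.
Context (m : nat) (xi : 'I_m -> T) (d : T -> T -> R) (r0 : R) (hth : T -> R).

(* The points of [T] are those of the support set; [hth] is h(theta, .). *)
Definition others : set T := ~` range xi.

(* [slice mu B] is mu(ds x B), as a function of the measurable set for ds. *)
Definition slice (mu : set (T * T) -> \bar R) (B : set T) : set T -> \bar R :=
  fun A => mu (A `*` B).

Definition CLP_feasible : set {measure set (T * T) -> \bar R} :=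
  [set mu | [/\ forall i, mu ([set: T] `*` [set xi i]) = (m%:R^-1)%:E,
      mu ([set: T] `*` others) = 0%E
    & (\sum_(i < m) \int[slice mu [set xi i]]_s (d s (xi i))%:E <= r0%:E)%E]].

Definition CLP_objective (mu : {measure set (T * T) -> \bar R}) : \bar R :=
  (\int[slice mu [set: T]]_s (hth s)%:E)%E.

Definition CLP_value : \bar R :=
  ereal_sup [set CLP_objective mu | mu in CLP_feasible].

(* The m + 1 cells of the partition: the sample singletons, then the rest. *)
Definition cell (j : 'I_(m + 1)) : set T :=
  match fintype.split j with
  | inl i => [set xi i]
  | inr _ => others
  end.

(* Conic data of (CLP). Coordinates of ['rV_(m + 1 + 1)]: the m samples, the
   cell [others], and the transport budget. *)
Definition psi_obj (s : T * T) : R := hth s.1.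

Definition psi_cost (s : T * T) : R :=
  \sum_(i < m) d s.1 s.2 * \1_[set xi i] s.2.

Definition psi_constr (j : 'I_(m + 1 + 1)) : T * T -> R :=
  match fintype.split j with
  | inl k => fun s => \1_(cell k) s.2
  | inr _ => psi_cost
  end.

Definition rhs : 'rV[R]_(m + 1 + 1) :=
  row_mx (row_mx (const_mx m%:R^-1) (const_mx 0)) (const_mx r0).

Definition constr_cone : set 'rV[R]_(m + 1 + 1) :=
  [set x | (forall j : 'I_(m + 1), x ord0 (lshift 1 j) = 0) /\
           x ord0 (rshift (m + 1) ord0) <= 0].

(* In ['rV_(m + 1)], [lshift 1 i] is the index of v_i and [rshift m ord0] that
   of v_(m+1). *)
Definition CLPD_feasible : set 'rV[R]_(m + 1) :=
  [set v | (forall s i, hth s - v ord0 (lshift 1 i)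
                        - v ord0 (rshift m ord0) * d s (xi i) <= 0) /\
           0 <= v ord0 (rshift m ord0)].

Definition CLPD_objective (v : 'rV[R]_(m + 1)) : R :=
  m%:R^-1 * (\sum_(i < m) v ord0 (lshift 1 i)) + r0 * v ord0 (rshift m ord0).

Definition CLPD_value : \bar R :=
  ereal_inf [set (CLPD_objective v)%:E | v in CLPD_feasible].

Definition CLPD_optimal : set 'rV[R]_(m + 1) :=
  [set v | CLPD_feasible v /\
           forall v', CLPD_feasible v' -> CLPD_objective v <= CLPD_objective v'].

(* v_i = - w_i and v_(m+1) = - w_(m+2); w_(m+1) is dropped. *)
Definition CLPD_of_dual (w : 'rV[R]_(m + 1 + 1)) : 'rV[R]_(m + 1) :=
  row_mx (\row_(i < m) - w ord0 (lshift 1 (lshift 1 i)))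
         (const_mx (- w ord0 (rshift (m + 1) ord0))).

Definition polytope_H (C1 C2 : R) : set 'rV[R]_(m + 1) :=
  [set v | (forall i : 'I_m,
              C1 <= v ord0 (lshift 1 i) <= m.+1%:R * C2 - m%:R * C1) /\
           0 <= v ord0 (rshift m ord0) <= (C2 - C1) / r0].

End WassersteinProgram.

(* (CLP) is the conic program with data [psi_obj], [psi_constr], [rhs] and
   [constr_cone]: same feasible measures, same objective, same value. *)
Section ConicForm.
Context {dT : measure_display} {T : measurableType dT} {R : realType}.
Context (m : nat) (xi : 'I_m -> T) (d : T -> T -> R) (r0 : R) (hth : T -> R)
  (m1 : forall x : T, measurable [set x]) (d_metric : is_metric d)
  (d_meas : measurable_fun [set: (T * T)%type] (fun s : T * T => d s.1 s.2)).

Lemma measurable_others : measurable (others xi).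
Proof.
apply: measurableC; rewrite -bigcup_imset1.
by apply: fin_bigcup_measurable => //; exact: finite_finset.
Qed.

Let mTB (B : set T) : measurable B -> measurable ([set: T] `*` B).
Proof. by move=> mB; exact: measurableX. Qed.

Lemma sliceE (mu : set (T * T)%type -> \bar R) (B : set T) (mB : measurable B) :
  slice mu B = pushforward (mrestr mu (mTB mB)) fst.
Proof.
apply/funext => A; rewrite /slice /pushforward /mrestr; congr (mu _).
by apply/seteqP; split => -[x y] /=; tauto.
Qed.

Lemma CLP_objectiveE (mu : {finite_measure set (T * T)%type -> \bar R}) :
  integrable_all (psi_obj hth) ->
  CLP_objective hth mu = (pairing mu (psi_obj hth))%:E.
Proof.
move=> psi0_int.
rewrite /pairing /Rintegral fineK; last first.
  by apply: integrable_fin_num => //; exact: psi0_int.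
rewrite /CLP_objective (sliceE mu measurableT).
rewrite (_ : mrestr mu _ = mu); last first.
  by apply/funext => A; rewrite /mrestr setXTT setIT.
have mh : measurable_fun [set: T] hth.
  have /measurable_int/measurable_EFinP mf := psi0_int mu.
  exact: (measurable_fun_pair1 point mf).
have {}mh : measurable_fun [set: T] (fun s => (hth s)%:E).
  exact/measurable_EFinP.
by rewrite (integral_pushforward measurable_fst)//; exact: psi0_int.
Qed.

Let xi_dist i x : 0 <= d x (xi i). Proof. by case: d_metric. Qed.

Lemma pairing_cost (mu : {finite_measure set (T * T)%type -> \bar R}) :
  integrable_all (psi_cost xi d) ->
  (\sum_(i < m) \int[slice mu [set xi i]]_s (d s (xi i))%:E
   = (pairing mu (psi_cost xi d))%:E)%E.
Proof.
move=> cost_int.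
rewrite /pairing /Rintegral fineK; last first.
  by apply: integrable_fin_num => //; exact: cost_int.
pose f i := fun s : T * T => (d s.1 s.2 * \1_[set xi i] s.2)%:E.
have f0 i s : (0 <= f i s)%E.
  by rewrite lee_fin mulr_ge0//; case: d_metric.
have mf i : measurable_fun [set: (T * T)%type] (f i).
  apply/measurable_EFinP; apply: measurable_funM => //.
  apply: (measurableT_comp (measurable_indic (m1 _))).
  exact: measurable_snd.
transitivity (\sum_(i < m) \int[mu]_s f i s)%E; last first.
  rewrite -ge0_integral_sum//; apply: eq_integral => s _.
  by rewrite /psi_cost sumEFin.
apply: eq_bigr => i _.
rewrite (sliceE mu (m1 (xi i))).
have mdi : measurable_fun [set: T] (fun s => (d s (xi i))%:E).
  by apply/measurable_EFinP; exact: (measurable_fun_pair1 (xi i) d_meas).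
rewrite (ge0_integral_pushforward measurable_fst)//; last first.
  by move=> s _; rewrite lee_fin.
rewrite preimage_setT.
set B := [set: T] `*` [set xi i].
have mB : measurable B by exact: mTB.
have fB s : (f i s = ((fun s => (d s.1 (xi i))%:E) \_ B) s)%E.
  rewrite /f /patch indicE; case: ifPn => [|nB].
    by rewrite inE => -[_ /= ->]; rewrite mem_set ?mulr1.
  rewrite memNset ?mulr0// => si; move/negP: nB; apply.
  by rewrite inE; split.
have mg : measurable_fun [set: (T * T)%type] (fun s : T * T => (d s.1 (xi i))%:E).
  by apply: (measurableT_comp mdi); exact: measurable_fst.
have g0 (s : T * T) : (0 <= (d s.1 (xi i))%:E)%E by rewrite lee_fin.
rewrite (eq_integral _ _ (fun s _ => fB s)) -integral_mkcond.
rewrite -[in LHS](setUv B) ge0_integral_setU//=; last 3 first.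
- exact: measurableC.
- by rewrite setUv.
- by apply/disj_setPCl.
rewrite [X in (_ + X)%E](_ : _ = 0%E) ?adde0.
  apply: eq_measure_integral => A mA AB.
  by rewrite /= /mrestr; congr (mu _); exact/setIidPl.
rewrite (eq_measure_integral mzero) ?integral_measure_zero// => A mA AB.
rewrite /= /mrestr [X in mu X](_ : _ = set0) ?measure0//.
by rewrite -subset0 => s [/AB].
Qed.

Lemma conic_feasibleE (mu : {finite_measure set (T * T)%type -> \bar R}) :
  integrable_all (psi_cost xi d) ->
  conic_feasible (psi_constr xi d) (rhs m r0) (@constr_cone R m) mu
  <-> CLP_feasible xi d r0 mu.
Proof.
move=> cost_int.
have cell_pair j : (pairing mu (psi_constr xi d (lshift 1 j)))%:E
                   = mu ([set: T] `*` cell xi j).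
  have mC : measurable (cell xi j).
    by rewrite /cell; case: fintype.split => // _; exact: measurable_others.
  rewrite /pairing /Rintegral /psi_constr -[lshift 1 j]/(unsplit (inl j)) unsplitK.
  rewrite (_ : (fun x : T * T => _) = EFin \o \1_([set: T] `*` cell xi j)).
    rewrite integral_indic//; last exact: mTB.
    by rewrite setIT fineK// fin_num_measure//; exact: mTB.
  apply/funext => -[x y] /=; rewrite !indicE; congr (_%:R%:E).
  by congr nat_of_bool; apply/idP/idP; rewrite !inE//= => -[].
have cost_pair : pairing mu (psi_constr xi d (rshift (m + 1) ord0))
                 = pairing mu (psi_cost xi d).
  by rewrite /psi_constr -[rshift _ _]/(unsplit (inr ord0)) unsplitK.
have cellL i : cell xi (lshift 1 i) = [set xi i].
  by rewrite /cell -[lshift 1 i]/(unsplit (inl i)) unsplitK.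
have cellR k : cell xi (rshift m k) = others xi.
  by rewrite /cell -[rshift m k]/(unsplit (inr k)) unsplitK.
have rhsL i : rhs m r0 ord0 (lshift 1 (lshift 1 i)) = m%:R^-1.
  by rewrite /rhs row_mxEl row_mxEl mxE.
have rhsM k : rhs m r0 ord0 (lshift 1 (rshift m k)) = 0.
  by rewrite /rhs row_mxEl row_mxEr mxE.
have rhsR k : rhs m r0 ord0 (rshift (m + 1) k) = r0.
  by rewrite /rhs row_mxEr mxE.
have entry j : (conic_map (psi_constr xi d) mu - rhs m r0) ord0 j
    = pairing mu (psi_constr xi d j) - rhs m r0 ord0 j.
  by rewrite mxE [X in X + _]mxE [X in _ + X]mxE.
rewrite /conic_feasible /CLP_feasible /constr_cone /=.
rewrite pairing_cost// lee_fin entry rhsR cost_pair subr_le0.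
split => [[E C]|[E1 E2 C]]; split => //.
- move=> i; have := E (lshift 1 i).
  rewrite entry rhsL => /eqP; rewrite subr_eq0 => /eqP Ei.
  by rewrite -cellL -cell_pair Ei.
- have := E (rshift m ord0).
  rewrite entry rhsM subr0 => Ei.
  by rewrite -(cellR ord0) -cell_pair Ei.
- move=> j; rewrite entry; apply/eqP; rewrite subr_eq0; apply/eqP.
  apply: EFin_inj; rewrite cell_pair.
  case: (split_ordP j) => k ->; first by rewrite cellL rhsL.
  by rewrite cellR rhsM.
Qed.

Lemma CLP_feasible_finite (mu : {measure set (T * T)%type -> \bar R}) :
  CLP_feasible xi d r0 mu ->
  exists nu : {finite_measure set (T * T)%type -> \bar R}, nu = mu :> (set _ -> _).
Proof.
case=> E1 E2 _.
have muT : (mu setT < +oo)%E.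
  pose A (o : option 'I_m) : set (T * T) :=
    [set: T] `*` (if o is Some i then [set xi i] else others xi).
  have mA o : measurable (A o).
    by case: o => [i|]; apply: mTB => //; exact: measurable_others.
  apply: (@le_lt_trans _ _ (\sum_(o \in [set: option 'I_m]) mu (A o))%E).
    apply: content_sub_fsum => //; first exact: finite_finset.
    move=> [x y] _; have [[i _ yi]|ny] := pselect (range xi y).
      by exists (Some i) => //; split.
    by exists None => //; split.
  have fO : finite_set [set: option 'I_m] by exact: finite_finset.
  rewrite (fsbig_finite _ _ fO) /=.
  apply: lte_sum_pinfty => -[i|] _.
    by rewrite /A E1 ltry.
  by rewrite /A E2 ltry.
exists (mfrestr measurableT muT).
by apply/funext => A; rewrite /= /mfrestr /mrestr setIT.
Qed.

Lemma CLP_conic_value :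
  integrable_all (psi_obj hth) -> integrable_all (psi_cost xi d) ->
  CLP_value xi d r0 hth
  = conic_value (psi_obj hth) (psi_constr xi d) (rhs m r0) (@constr_cone R m).
Proof.
move=> psi0_int cost_int; congr ereal_sup; apply/seteqP; split => _ [mu muP <-].
  have [nu nuE] := CLP_feasible_finite muP.
  pose nu' : {measure set (T * T)%type -> \bar R} := nu.
  have {}nuE : nu' = mu :> (set _ -> _) by [].
  exists nu; last by rewrite -CLP_objectiveE// -/nu' /CLP_objective nuE.
  apply/conic_feasibleE => //; rewrite -/nu'.
  by move: muP; rewrite /CLP_feasible /= nuE.
exists mu; first exact/conic_feasibleE.
exact: CLP_objectiveE.
Qed.

End ConicForm.

(* Main.v *)
(** Weak duality follows by integrating [h s <= v_i + v_(m+1) d(s, xi_i)]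
    against the slices [mu(ds x {xi_i})], each of mass [1/m].

    For strong duality, a choice [s] of one destination [s_i] per sample yields
    the pair (mean of [d (s_i, xi_i)], mean of [h (s_i)]), and a mixture of two
    choices is realized by a finitely supported feasible measure as soon as its
    mean cost is at most [r0]. Since [r0] exceeds the cost [0] of leaving the
    samples in place, a line of slope [l >= 0] through [(r0, value of (CLP))]
    dominates all these pairs. With [v_i = sup_s (h s - l d(s, xi_i))] and
    [v_(m+1) = l] one gets a dual feasible point of objective at most the value
    of (CLP), so the duality gap closes and the dual minimum is attained.

    Dirac masses at [(x, xi_i)] turn the constraint of the conic dual into the
    constraints of (CLP-D). *)

Require Import Defs.
From HB Require Import structures.
From mathcomp Require Import all_boot all_order all_algebra.
From mathcomp Require Import all_classical all_reals all_analysis measurable_realfun.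
From mathcomp Require Import lra.

Set Implicit Arguments.
Unset Strict Implicit.
Unset Printing Implicit Defensive.

Import Order.TTheory GRing.Theory Num.Theory.
Import numFieldNormedType.Exports.

Local Open Scope classical_set_scope.
Local Open Scope ring_scope.

(** * Supporting slopes in the plane and sums of suprema *)

(** The slope must be at least [(q.2 - V) / (q.1 - r)] for every [q] to the right of [r] and at most
    [(V - p.2) / (r - p.1)] for every [p] to its left. The mixture hypothesis orders these two
    families, and a point strictly to the left makes the supremum of the first one finite. *)
Lemma supporting_slope (R : realType) (Q : set (R * R)) (r V : R) :
  (exists2 p, Q p & p.1 < r) ->
  (forall p q t, Q p -> Q q -> 0 <= t <= 1 ->
     t * p.1 + (1 - t) * q.1 <= r -> t * p.2 + (1 - t) * q.2 <= V) ->
  exists2 l, 0 <= l & forall p, Q p -> p.2 - l * (p.1 - r) <= V.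
Proof.
move=> [p0 Qp0 p0r] QV.
have QVr p : Q p -> p.1 <= r -> p.2 <= V.
  move=> Qp pr; have := QV p p 1 Qp Qp.
  by rewrite subrr !mul0r !addr0 !mul1r ler01 lexx => ->.
(* The element 0 makes [S] nonempty and its supremum nonnegative. *)
pose S : set R := [set l | l = 0 \/
  exists2 q, Q q & r < q.1 /\ l = (q.2 - V) / (q.1 - r)].
have S_ub p : Q p -> p.1 < r -> ubound S ((V - p.2) / (r - p.1)).
  move=> Qp pr _ [->|[q Qq [rq ->]]].
    by rewrite divr_ge0// subr_ge0 ?QVr// ltW.
  rewrite ler_pdivrMr ?subr_gt0// mulrAC ler_pdivlMr ?subr_gt0//.
  have qp0 : 0 < q.1 - p.1 by lra.
  (* With this weight the first coordinate of the mixture is exactly [r]. *)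
  have := QV p q ((q.1 - r) / (q.1 - p.1)) Qp Qq.
  have -> : 1 - (q.1 - r) / (q.1 - p.1) = (r - p.1) / (q.1 - p.1).
    by rewrite -[X in X - _](divff (lt0r_neq0 qp0)) -mulrBl; congr (_ / _); lra.
  rewrite !(mulrAC _ _^-1) -!mulrDl !ler_pdivrMr// divr_ge0 ?(ltW qp0)//; last lra.
  rewrite mul1r => QVt.
  have {}QVt := QVt ltac:(apply/andP; split => //; lra) ltac:(lra).
  lra.
have S0 : S 0 by left.
have S_sup : has_sup S by split; [exists 0|exists ((V - p0.2) / (r - p0.1)); exact: S_ub].
exists (sup S); first by apply: ub_le_sup => //; exact: S_sup.2.
move=> p Qp; have [pr|rp|pr] := ltgtP p.1 r.
- have : sup S <= (V - p.2) / (r - p.1) by apply: ge_sup; [exists 0|exact: S_ub].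
  rewrite ler_pdivlMr ?subr_gt0//; lra.
- have : (p.2 - V) / (p.1 - r) <= sup S.
    by apply: ub_le_sup; [exact: S_sup.2|right; exists p].
  rewrite ler_pdivrMr ?subr_gt0//; lra.
- by rewrite pr subrr mulr0 subr0 QVr// pr.
Qed.

(** The arguments of the summands are chosen independently, so near-maximizers of all the [f i]
    combine into a single [s]. *)
Lemma sum_sup_le (R : realType) (I : finType) (T : Type) (f : I -> T -> R) (B : R) :
  (forall i, has_sup (range (f i))) ->
  (forall s : I -> T, \sum_i f i (s i) <= B) ->
  \sum_i sup (range (f i)) <= B.
Proof.
move=> fsup fB; apply/ler_addgt0Pr => e e0.
(* The [+ 1] keeps the denominator positive for empty [I]; the accumulated error still stays below
   [e]. *)
pose e' := e / (#|I|%:R + 1).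
have e'0 : 0 < e' by rewrite divr_gt0// ltr_wpDl.
have /choice[s sP] i : exists s, sup (range (f i)) - e' < f i s.
  by have [_ [s _ <-] ?] := sup_adherent e'0 (fsup i); exists s.
apply: (@le_trans _ _ (\sum_i (f i (s i) + e'))).
  by apply: ler_sum => i _; rewrite -lerBlDr ltW.
rewrite big_split/= lerD// sumr_const -[e' *+ _]mulr_natl /e'.
by rewrite mulrCA ler_piMr ?(ltW e0)// ler_pdivrMr ?mul1r ?lerDl// ltr_wpDl.
Qed.

(** * Finite sums of measures and integrals against finitely many atoms *)

Section FiniteSums.
Context {dS : measure_display} {S : measurableType dS} {R : realType} (I : finType).
Implicit Types (M : I -> {measure set S -> \bar R}) (mu : {measure set S -> \bar R}).

(** [msum] takes a family indexed by natural numbers; [mzero] fills the indices from [#|I|] on,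
    which the sums below never reach. *)
Let enum_measure M (k : nat) : {measure set S -> \bar R} :=
  if (insub k : option 'I_#|I|) is Some j then M (enum_val j) else mzero.

Let enum_measureE M (F : {measure set S -> \bar R} -> \bar R) :
  (\sum_(k < #|I|) F (enum_measure M k) = \sum_i F (M i))%E.
Proof.
rewrite [RHS](reindex_onto (@enum_val I predT) enum_rank) => [|i _]; last exact: enum_rankK.
apply: eq_big => [j|j _]; first by rewrite enum_valK eqxx.
by rewrite /enum_measure valK.
Qed.

Lemma sum_measure M :
  exists mu, forall A, (mu A = \sum_i M i A)%E.
Proof.
by exists (msum (enum_measure M) #|I|) => A; rewrite -(enum_measureE M (fun nu => nu A)).
Qed.

Lemma ge0_integral_sum_measure M mu (f : S -> \bar R) :
  (forall A, measurable A -> (mu A = \sum_i M i A)%E) ->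
  (forall x, (0 <= f x)%E) -> measurable_fun [set: S] f ->
  (\int[mu]_x f x = \sum_i \int[M i]_x f x)%E.
Proof.
move=> muE f0 mf.
rewrite (eq_measure_integral (msum (enum_measure M) #|I|)); last first.
  by move=> A mA _; rewrite muE// -(enum_measureE M (fun nu => nu A)).
by rewrite ge0_integral_measure_sum// (enum_measureE M (fun nu => \int[nu]_x f x)%E).
Qed.

(** Positive and negative parts are summed separately; integrability makes the integrals of the
    negative part finite, so the two sums can be subtracted termwise. *)
Lemma integral_sum_measure M mu (f : S -> \bar R) :
  (forall A, measurable A -> (mu A = \sum_i M i A)%E) ->
  (forall i, (M i).-integrable [set: S] f) -> measurable_fun [set: S] f ->
  (\int[mu]_x f x = \sum_i \int[M i]_x f x)%E.
Proof.
move=> muE intf mf; rewrite integralE.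
rewrite (ge0_integral_sum_measure (f := (f^\+)%E) muE)//; last exact: measurable_funepos.
rewrite (ge0_integral_sum_measure (f := (f^\-)%E) muE)//; last exact: measurable_funeneg.
rewrite [RHS](eq_bigr _ (fun i _ => integralE (M i) setT f)).
rewrite [RHS]big_split/= fin_num_sumeN// => i _.
exact: integrable_neg_fin_num.
Qed.

(** Since [f] is real-valued, each of its two parts integrates to a finite sum of reals, and the
    subtraction takes place in [R]. *)
Lemma integral_atoms mu (c : I -> R) (a : I -> S) (f : S -> R) :
  (forall i, 0 <= c i) ->
  (forall A, measurable A -> (mu A = \sum_i (c i)%:E * \d_(a i) A)%E) ->
  measurable_fun [set: S] f ->
  (\int[mu]_x (f x)%:E = (\sum_i c i * f (a i))%:E)%E.
Proof.
move=> c0 muE /measurable_EFinP mf.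
have ge0_atoms g : (forall x, (0 <= g x)%E) -> measurable_fun [set: S] g ->
    (\int[mu]_x g x = \sum_i (c i)%:E * g (a i))%E.
  move=> g0 mg.
  rewrite (ge0_integral_sum_measure (M := fun i => mscale (NngNum (c0 i)) \d_(a i)))//.
  apply: eq_bigr => i _.
  by rewrite ge0_integral_mscale// integral_dirac// diracT mul1e.
have mfp := measurable_funepos mf; have mfn := measurable_funeneg mf.
rewrite integralE (ge0_atoms _ _ mfp)// (ge0_atoms _ _ mfn)//.
rewrite funerpos funerneg.
under eq_bigr do rewrite -EFinM.
under [X in (_ - X)%E]eq_bigr do rewrite -EFinM.
rewrite !sumEFin -EFinB -sumrB; congr EFin; apply: eq_bigr => i _.
by rewrite -mulrBr -[f in RHS]funrposBneg.
Qed.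
End FiniteSums.

(** * Slices of transport measures and weak duality *)

Section Slices.
Context {dT : measure_display} {T : measurableType dT} {R : realType}.
Context (m : nat) (xi : 'I_m -> T) (d : T -> T -> R) (r0 : R) (hth : T -> R).
Context (m1 : forall x : T, measurable [set x]) (d_metric : is_metric d)
  (d_meas : measurable_fun [set: (T * T)%type] (fun s : T * T => d s.1 s.2))
  (m_gt0 : (0 < m)%N) (xi_inj : injective xi).

(** In (CLP) a slice is a bare set function; being a pushforward of a restriction of [mu], it
    carries the measure structure that the integration lemmas require. *)
Lemma slice_measure (mu : {measure set (T * T) -> \bar R}) (B : set T) :
  measurable B ->
  exists nu : {measure set T -> \bar R}, nu = slice mu B :> (set T -> \bar R).
Proof.
move=> mB; rewrite (sliceE hth mu mB).
pose nu := pushforward (mrestr mu (measurableX measurableT mB)) (@fst T T).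
apply: (ex_intro _ _ (erefl nu)).
exact: measurable_fst.
Qed.

Lemma slice_samples (mu : {measure set (T * T) -> \bar R}) (A : set T) :
  measurable A -> mu ([set: T] `*` others xi) = 0%E ->
  (slice mu [set: T] A = \sum_i slice mu [set xi i] A)%E.
Proof.
move=> mA mu0; rewrite /slice.
have mo := measurable_others xi m1.
have mAi i : measurable (A `*` [set xi i]) by exact: measurableX.
have mU : measurable (\big[setU/set0]_i (A `*` [set xi i])).
  exact: bigsetU_measurable.
(* The columns over the samples are disjoint because the samples are distinct, and the remaining
   column is null. *)
rewrite (_ : A `*` setT = \big[setU/set0]_i (A `*` [set xi i]) `|` A `*` others xi).
  rewrite measureU//=; last 2 first.
  - exact: measurableX.
  - rewrite -bigcup_seq -subset0 => -[x y] [[i _ [_ /= ->]]] [_ /=].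
    by apply; exists i.
  rewrite [X in (_ + X)%E](subset_measure0 _ _ _ mu0) ?adde0//; last 3 first.
  - exact: measurableX.
  - exact: measurableX.
  - by move=> [x y] [].
  rewrite measure_semi_additive_ord//.
  apply/trivIsetP => i j _ _ ij; rewrite -subset0.
  by move=> [x y] [[_ /= ->] [_ /= /xi_inj]]; exact/eqP.
rewrite -bigcup_seq; apply/seteqP; split => [[x y] [/= Ax _]|[x y] [[i _ []]|[]]//].
have [[i _ yi]|ny] := pselect (range xi y); last by right.
by left; exists i => //=; rewrite mem_index_enum.
Qed.

Lemma weak_duality (M : R) (mu : {measure set (T * T) -> \bar R}) (v : 'rV[R]_(m + 1)) :
  measurable_fun [set: T] hth -> (forall s, `|hth s| <= M) ->
  CLP_feasible xi d r0 mu -> CLPD_feasible xi d hth v ->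
  (CLP_objective hth mu <= (CLPD_objective r0 v)%:E)%E.
Proof.
move=> mh hM [mui muo cost] [hv l0].
set l := v ord0 (rshift m ord0) in hv l0 *.
have /choice[nu nuE] i : exists nu : {measure set T -> \bar R},
    nu = slice mu [set xi i] :> (set T -> \bar R) by exact: slice_measure.
have [nuT nuTE] := slice_measure mu measurableT.
have nui i : nu i setT = (m%:R^-1)%:E by rewrite nuE; exact: mui.
have d0 i x : 0 <= d x (xi i) by case: d_metric.
have md i : measurable_fun [set: T] (fun s => d s (xi i)).
  exact: (measurable_fun_pair1 (xi i) d_meas).
have int_d0 i : (0 <= \int[nu i]_s (d s (xi i))%:E)%E.
  by apply: integral_ge0 => s _; rewrite lee_fin.
have cost' : (\sum_(i < m) \int[nu i]_s (d s (xi i))%:E <= r0%:E)%E.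
  by apply: le_trans cost; apply: lee_sum => i _; rewrite nuE.
(* Each transport integral is one term of a nonnegative sum bounded by [r0]. *)
have int_doo i : (\int[nu i]_s (d s (xi i))%:E < +oo)%E.
  apply: le_lt_trans (ltry r0); apply: le_trans cost'.
  by rewrite (bigD1 i)//= leeDl// sume_ge0.
have int_d i : (nu i).-integrable [set: T] (fun s => (d s (xi i))%:E).
  apply/integrableP; split; first exact/measurable_EFinP.
  by under eq_integral do rewrite gee0_abs ?lee_fin//.
have int_bnd i (f : T -> R) (K : R) : 
    measurable_fun [set: T] f -> (forall s, `|f s| <= K) ->
    (nu i).-integrable [set: T] (EFin \o f).
  move=> mf fK; apply: measurable_bounded_integrable => //.
    by rewrite nui ltry.
  exists K; split; first exact: num_real.
  by move=> x Kx s _; exact: le_trans (fK s) (ltW Kx).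
pose D i := fine (\int[nu i]_s (d s (xi i))%:E)%E.
have DE i : (\int[nu i]_s (d s (xi i))%:E)%E = (D i)%:E.
  by rewrite fineK// ge0_fin_numE.
have D_le : \sum_i D i <= r0.
  by rewrite -lee_fin -sumEFin; under eq_bigr do rewrite -DE.
rewrite /CLP_objective -nuTE (integral_sum_measure (M := nu)); last 3 first.
- by move=> A mA; rewrite nuTE slice_samples//; apply: eq_bigr => i _; rewrite nuE.
- by move=> i; exact: int_bnd mh hM.
- exact/measurable_EFinP.
(* The dual objective is bounded below by one term per sample: the budget [r0] is replaced by the
   actual total cost, which is legitimate since [l >= 0]. *)
apply: (@le_trans _ _ (\sum_i (m%:R^-1 * v ord0 (lshift 1 i) + l * D i)%:E)%E); last first.
  rewrite sumEFin lee_fin big_split/= -mulr_sumr -mulr_sumr lerD2l mulrC.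
  by rewrite ler_wpM2r.
apply: lee_sum => i _.
have int_v : (nu i).-integrable [set: T] (cst (v ord0 (lshift 1 i))%:E).
  exact: (int_bnd i (cst (v ord0 (lshift 1 i))) `|v ord0 (lshift 1 i)|).
have int_ld : (nu i).-integrable [set: T] (fun s => l%:E * (d s (xi i))%:E)%E.
  exact: integrableZl.
apply: (@le_trans _ _ (\int[nu i]_s
    (cst (v ord0 (lshift 1 i))%:E s + l%:E * (d s (xi i))%:E))%E).
  apply: le_integral => //; first exact: int_bnd mh hM.
    exact: integrableD.
  move=> s _; rewrite -EFinM -EFinD lee_fin.
  by have := hv s i; rewrite -addrA -opprD subr_le0.
rewrite integralD// integralZl// DE integral_cst// nui.
by rewrite -!EFinM -EFinD mulrC.
Qed.

(** * Feasible measures with finite support *)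

(** Each sample [xi i] receives mass [t / m] from [s true i] and [(1 - t) / m] from [s false i]. All
    constraints and the objective then become finite weighted sums. *)
Lemma two_point_measure (t : R) (s : bool -> 'I_m -> T) :
  measurable_fun [set: T] hth -> 0 <= t <= 1 ->
  t * (m%:R^-1 * \sum_i d (s true i) (xi i)) +
    (1 - t) * (m%:R^-1 * \sum_i d (s false i) (xi i)) <= r0 ->
  exists2 mu, CLP_feasible xi d r0 mu & CLP_objective hth mu =
    (t * (m%:R^-1 * \sum_i hth (s true i)) +
     (1 - t) * (m%:R^-1 * \sum_i hth (s false i)))%:E.
Proof.
move=> mh /andP[t0 t1] cost.
pose w (p : bool * 'I_m) : R := (if p.1 then t else 1 - t) * m%:R^-1.
have w0 p : 0 <= w p.
  by rewrite mulr_ge0 ?invr_ge0 ?ler0n//; case: p.1 => //; rewrite subr_ge0.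
have sumw (F : bool -> 'I_m -> R) : \sum_p w p * F p.1 p.2 =
    t * (m%:R^-1 * \sum_i F true i) + (1 - t) * (m%:R^-1 * \sum_i F false i).
  rewrite -(pair_bigA _ (fun b i => w (b, i) * F b i))/= big_bool.
  by congr (_ + _); rewrite mulrA mulr_sumr.
(* Restriction to the column of sample [i] leaves only its two atoms. *)
have sumw_i (F : bool -> 'I_m -> R) i : \sum_p w p * (p.2 == i)%:R * F p.1 p.2 =
    t * (m%:R^-1 * F true i) + (1 - t) * (m%:R^-1 * F false i).
  under eq_bigr do rewrite -mulrA.
  have pick (G : 'I_m -> R) : \sum_j (j == i)%:R * G j = G i.
    rewrite (bigD1 i)//= eqxx mul1r big1 ?addr0// => j /negPf ->.
    by rewrite mul0r.
  by rewrite (sumw (fun b j => (j == i)%:R * F b j)) !pick.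
have [mu muE] := sum_measure
  (fun p => mscale (NngNum (w0 p)) \d_(s p.1 p.2, xi p.2) : {measure set (T * T) -> \bar R}).
have mu_slice B A : (slice mu B A =
    \sum_p (w p * (xi p.2 \in B)%:R)%:E * \d_(s p.1 p.2) A)%E.
  rewrite /slice muE; apply: eq_bigr => p _.
  rewrite /mscale/= !diracE EFinM -muleA -EFinM -natrM mulnb.
  congr (_ * (nat_of_bool _)%:R%:E)%E.
  by apply/idP/andP; rewrite !inE/= => -[].
have int_slice B f : measurable B -> measurable_fun [set: T] f ->
    (\int[slice mu B]_x (f x)%:E =
     (\sum_p w p * (xi p.2 \in B)%:R * f (s p.1 p.2))%:E)%E.
  move=> mB mf; have [nu nuE] := slice_measure mu mB.
  rewrite -nuE; apply: integral_atoms => // [p|A mA]; first by rewrite mulr_ge0.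
  by rewrite nuE mu_slice.
have in1 i (p : bool * 'I_m) : (xi p.2 \in [set xi i]) = (p.2 == i).
  by apply/idP/eqP => [/set_mem/xi_inj|->]; last exact: mem_set.
have mass B : (mu ([set: T] `*` B) = (\sum_p w p * (xi p.2 \in B)%:R)%:E)%E.
  rewrite -[LHS]/(slice mu B setT) mu_slice -sumEFin.
  by apply: eq_bigr => p _; rewrite diracT mule1.
exists mu; first split.
- move=> i; rewrite mass; congr EFin.
  (* The factor 1 matches the form of [sumw_i] with a constant [F]. *)
  transitivity (\sum_p w p * (p.2 == i)%:R * 1).
    by apply: eq_bigr => p _; rewrite in1 mulr1.
  by rewrite (sumw_i (fun _ _ => 1)) -mulrDl addrCA subrr addr0 mul1r mulr1.
- rewrite mass big1// => p _; rewrite memNset ?mulr0// => np.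
  by apply: np; exists p.2.
- rewrite -lee_fin in cost; apply: le_trans cost.
  rewrite le_eqVlt; apply/orP; left; apply/eqP.
  transitivity (\sum_i (t * (m%:R^-1 * d (s true i) (xi i)) +
      (1 - t) * (m%:R^-1 * d (s false i) (xi i)))%:E)%E.
    apply: eq_bigr => i _; rewrite int_slice//; last first.
      exact: (measurable_fun_pair1 (xi i) d_meas).
    rewrite -(sumw_i (fun b j => d (s b j) (xi i))); congr EFin.
    by apply: eq_bigr => p _; rewrite in1.
  by rewrite sumEFin big_split/= -!mulr_sumr.
- rewrite /CLP_objective int_slice//; congr EFin.
  rewrite -(sumw (fun b i => hth (s b i))).
  by apply: eq_bigr => p _; rewrite in_setT mulr1.
Qed.

(** * Feasible and optimal points of (CLP-D) *)

Lemma CLPD_feasible_ge (v : 'rV[R]_(m + 1)) i :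
  CLPD_feasible xi d hth v -> hth (xi i) <= v ord0 (lshift 1 i).
Proof.
move=> [hv _]; have := hv (xi i) i.
have -> : d (xi i) (xi i) = 0 by case: d_metric => _ /(_ (xi i) (xi i)) [_ ->].
by rewrite mulr0 subr0 subr_le0.
Qed.

(** This point bounds the optimal value from above: it shows that (CLP) has a finite value and
    confines the minimizers to the polytope. *)
Lemma CLPD_constant_feasible (M : R) :
  (forall s, hth s <= M) ->
  CLPD_feasible xi d hth (row_mx (const_mx M) (const_mx 0)) /\
  CLPD_objective r0 (row_mx (const_mx M) (const_mx 0) : 'rV[R]_(m + 1)) = M.
Proof.
move=> hM; split; first split.
- by move=> s i; rewrite row_mxEl row_mxEr !mxE mul0r subr0 subr_le0.
- by rewrite row_mxEr mxE.
rewrite /CLPD_objective row_mxEr mxE mulr0 addr0.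
under eq_bigr do rewrite row_mxEl mxE.
by rewrite sumr_const card_ord -[M *+ m]mulr_natl mulKf// pnatr_eq0 -lt0n.
Qed.

(** An optimal point does no worse than the constant point of objective [C2]. As every [v_i] is at
    least [C1], little room is left for a single coordinate or for the multiplier. *)
Lemma CLPD_optimal_in_polytope (C1 C2 : R) :
  0 < r0 -> (forall s, C1 <= hth s <= C2) ->
  CLPD_optimal xi d r0 hth `<=` polytope_H r0 C1 C2.
Proof.
move=> r0_gt0 hC v [fv optv].
have [fC objC] := CLPD_constant_feasible (fun s => (andP (hC s)).2).
have := optv _ fC; rewrite objC /CLPD_objective.
set l := v ord0 (rshift m ord0).
have l0 : 0 <= l by case: fv.
have C12 : C1 <= C2 by have /andP[] := hC point; exact: le_trans.
have vC1 i : C1 <= v ord0 (lshift 1 i).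
  by apply: le_trans (CLPD_feasible_ge i fv); have /andP[] := hC (xi i).
have m0 : 0 < m%:R :> R by rewrite ltr0n.
rewrite mulrC -(ler_pM2r m0) mulrDl divfK ?gt_eqF// => vC2.
have rl0 : 0 <= r0 * l by rewrite mulr_ge0// ltW.
split=> [i|]; rewrite ?vC1 ?l0 ?andTb.
  (* Bounding the other coordinates below by [C1] gives [v_i <= m C2 - (m - 1) C1], which lies below
     the stated bound because [C1 <= C2]. *)
  move: vC2; rewrite (bigD1 i)//=.
  have : \sum_(j < m | j != i) C1 <= \sum_(j < m | j != i) v ord0 (lshift 1 j).
    exact: ler_sum.
  have -> : \sum_(j < m | j != i) C1 = m%:R * C1 - C1.
    rewrite mulr_natl -[m in RHS]card_ord -sumr_const [in RHS](bigD1 i)//=.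
    rewrite [RHS]addrAC subrr add0r.
    exact: eq_bigl.
  have := mulr_ge0 rl0 (ltW m0).
  rewrite -natr1; lra.
rewrite ler_pdivlMr// -(ler_pM2r m0) -/l.
have : m%:R * C1 <= \sum_(j < m) v ord0 (lshift 1 j).
  by rewrite mulr_natl -[m in X in X <= _]card_ord -sumr_const; exact: ler_sum.
lra.
Qed.

(** * Attainment and strong duality *)

Lemma CLPD_attained (M : R) :
  0 < r0 -> measurable_fun [set: T] hth -> (forall s, `|hth s| <= M) ->
  exists2 v, CLPD_feasible xi d hth v &
    ((CLPD_objective r0 v)%:E <= CLP_value xi d r0 hth)%E.
Proof.
move=> r0_gt0 mh hM.
have dxx x : d x x = 0 by case: d_metric => _ /(_ x x) [_ ->].
have d0 x y : 0 <= d x y by case: d_metric.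
have hMl s : hth s <= M by exact: le_trans (ler_norm _) (hM s).
pose avg (f : 'I_m -> R) := m%:R^-1 * \sum_i f i.
have value_ge t s : 0 <= t <= 1 ->
    t * avg (fun i => d (s true i) (xi i)) +
      (1 - t) * avg (fun i => d (s false i) (xi i)) <= r0 ->
    ((t * avg (fun i => hth (s true i)) +
      (1 - t) * avg (fun i => hth (s false i)))%:E
     <= CLP_value xi d r0 hth)%E.
  move=> t01 cost; have [mu fmu <-] := two_point_measure mh t01 cost.
  by apply: ereal_sup_ubound; exists mu.
have avg_xi : avg (fun i => d (xi i) (xi i)) = 0.
  by rewrite /avg big1 ?mulr0.
(* The lower bound comes from leaving the samples in place, the upper one from weak duality at the
   constant point. *)
have value_fin : CLP_value xi d r0 hth \is a fin_num.
  rewrite fin_numElt; apply/andP; split.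
    apply: lt_le_trans (ltNyr _) (value_ge 1 (fun _ => xi) _ _).
      by rewrite ler01 lexx.
    by rewrite avg_xi !mulr0 addr0 ltW.
  apply: le_lt_trans (ltry M); apply/ereal_supP => _ [mu fmu <-].
  have [fM objM] := CLPD_constant_feasible hMl.
  by rewrite -objM; exact: weak_duality mh hM fmu fM.
set V := fine (CLP_value xi d r0 hth).
have VE : V%:E = CLP_value xi d r0 hth by rewrite fineK.
rewrite -VE in value_ge *.
pose Q : set (R * R) := range (fun s : 'I_m -> T =>
  (avg (fun i => d (s i) (xi i)), avg (fun i => hth (s i)))).
have [] := @supporting_slope R Q r0 V.
- exists (avg (fun i => d (xi i) (xi i)), avg (fun i => hth (xi i))); first by exists xi.
  by rewrite /= avg_xi.
- move=> _ _ t [s1 _ <-] [s2 _ <-] t01 /= cost.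
  by have := value_ge t (fun b => if b then s1 else s2) t01 cost; rewrite lee_fin.
move=> l l0 lV.
(* For the multiplier [l], the supremum of [f i] is the least admissible [v_i]. *)
pose f i s := hth s - l * d s (xi i).
have f_sup i : has_sup (range (f i)).
  split; first by exists (f i (xi i)), (xi i).
  by exists M => _ [s _ <-]; rewrite lerBlDr ler_wpDr// mulr_ge0.
have m0 : 0 < m%:R :> R by rewrite ltr0n.
(* For each choice [s], the required bound is the supporting inequality [lV] multiplied by [m]. *)
have sum_f : \sum_i sup (range (f i)) <= m%:R * (V - r0 * l).
  apply: sum_sup_le => // s; rewrite -ler_pdivrMl//.
  have := lV _ (ex_intro2 _ _ s Logic.I erefl); rewrite /= /avg /f sumrB -mulr_sumr.
  lra.
exists (row_mx (\row_i sup (range (f i))) (const_mx l)).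
  split; last by rewrite row_mxEr mxE.
  move=> s i; rewrite row_mxEl row_mxEr !mxE addrAC subr_le0.
  by apply: ub_le_sup; [exact: (f_sup i).2|exists s].
rewrite lee_fin /CLPD_objective row_mxEr mxE.
under eq_bigr do rewrite row_mxEl mxE.
by rewrite -lerBrDr ler_pdivrMl.
Qed.

(** Weak duality puts every dual objective above the value of (CLP), so a feasible point that does
    not exceed this value is a minimizer and closes the gap. *)
Lemma CLP_strong_duality (M : R) :
  0 < r0 -> measurable_fun [set: T] hth -> (forall s, `|hth s| <= M) ->
  (exists v, CLPD_optimal xi d r0 hth v) /\
  CLP_value xi d r0 hth = CLPD_value xi d r0 hth.
Proof.
move=> r0_gt0 mh hM.
have [v fv vV] := CLPD_attained r0_gt0 mh hM.
have weak v' : CLPD_feasible xi d hth v' ->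
    (CLP_value xi d r0 hth <= (CLPD_objective r0 v')%:E)%E.
  by move=> fv'; apply/ereal_supP => _ [mu fmu <-]; exact: weak_duality mh hM fmu fv'.
split.
  by exists v; split => // v' fv'; rewrite -lee_fin (le_trans vV)// weak.
apply/eqP; rewrite eq_le; apply/andP; split.
  by apply/ereal_infP => _ [v' fv' <-]; exact: weak.
by apply: le_trans vV; apply: ereal_inf_lbound; exists v.
Qed.

End Slices.

(** * The conic dual in coordinates *)

Section ConicDual.
Context {dT : measure_display} {T : measurableType dT} {R : realType}.
Context (m : nat) (xi : 'I_m -> T) (d : T -> T -> R) (r0 : R) (hth : T -> R).
Context (m1 : forall x : T, measurable [set x]) (d_metric : is_metric d)
  (xi_inj : injective xi).

(** The multiplier of [others] meets the entry 0 of [rhs], so dropping it does not change the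
    objective. *)
Lemma conic_dual_objectiveE (w : 'rV[R]_(m + 1 + 1)) :
  conic_dual_objective (rhs m r0) w = CLPD_objective r0 (CLPD_of_dual w).
Proof.
rewrite /conic_dual_objective /dotp /CLPD_objective /CLPD_of_dual.
rewrite !big_split_ord/= !big_ord1 /rhs !row_mxEr !row_mxEl !row_mxEr !mxE mul0r addr0.
under eq_bigr do rewrite !row_mxEl mxE.
under [in RHS]eq_bigr do rewrite row_mxEl mxE.
by rewrite sumrN !mulrN -opprD -mulr_sumr.
Qed.

Lemma dual_coneE (w : 'rV[R]_(m + 1 + 1)) :
  dual_cone (@constr_cone R m) w <-> w ord0 (rshift (m + 1) ord0) <= 0.
Proof.
split=> [Kw|w0 x [xE x0]].
  (* The test vector is the extreme ray of [constr_cone], along the budget coordinate. *)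
  have : 0 <= dotp (row_mx (const_mx 0) (const_mx (-1))) w.
    apply: Kw; split=> [j|]; first by rewrite row_mxEl mxE.
    by rewrite row_mxEr mxE oppr_le0.
  rewrite /dotp big_split_ord/= big_ord1 big1 => [|i _]; last by rewrite row_mxEl mxE mul0r.
  by rewrite row_mxEr mxE add0r mulN1r oppr_ge0.
rewrite /dotp big_split_ord/= big_ord1 big1 => [|i _]; last by rewrite xE mul0r.
by rewrite add0r mulr_le0.
Qed.

Lemma conic_adjointE (w : 'rV[R]_(m + 1 + 1)) (s : T * T) :
  conic_adjoint (psi_constr xi d) w s =
  \sum_(i < m) w ord0 (lshift 1 (lshift 1 i)) * \1_[set xi i] s.2 +
  w ord0 (lshift 1 (rshift m ord0)) * \1_(others xi) s.2 +
  w ord0 (rshift (m + 1) ord0) * psi_cost xi d s.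
Proof.
have psiL k : psi_constr xi d (lshift 1 k) = (fun s => \1_(cell xi k) s.2).
  by rewrite /psi_constr -[lshift 1 k]/(unsplit (inl k)) unsplitK.
have psiR k : psi_constr xi d (rshift (m + 1) k) = psi_cost xi d.
  by rewrite /psi_constr -[rshift _ _]/(unsplit (inr k)) unsplitK.
have cellL i : cell xi (lshift 1 i) = [set xi i].
  by rewrite /cell -[lshift 1 i]/(unsplit (inl i)) unsplitK.
have cellR k : cell xi (rshift m k) = others xi.
  by rewrite /cell -[rshift m k]/(unsplit (inr k)) unsplitK.
rewrite /conic_adjoint !big_split_ord/= !big_ord1 psiR psiL cellR; congr (_ + _ + _).
by apply: eq_bigr => i _; rewrite psiL cellL.
Qed.

Lemma indic_sample i j : \1_[set xi i] (xi j) = (i == j)%:R :> R.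
Proof.
rewrite indicE; congr (_%:R); congr nat_of_bool.
by apply/idP/eqP => [/set_mem/xi_inj|->]; last exact: mem_set.
Qed.

Lemma sum_indic_sample (F : 'I_m -> R) i :
  \sum_j F j * \1_[set xi j] (xi i) = F i.
Proof.
rewrite (bigD1 i)//= indic_sample eqxx mulr1 big1 ?addr0// => j /negPf ij.
by rewrite indic_sample ij mulr0.
Qed.

Lemma conic_adjoint_sample (w : 'rV[R]_(m + 1 + 1)) (x : T) i :
  conic_adjoint (psi_constr xi d) w (x, xi i) =
  w ord0 (lshift 1 (lshift 1 i)) + w ord0 (rshift (m + 1) ord0) * d x (xi i).
Proof.
rewrite conic_adjointE /psi_cost/= !sum_indic_sample indicE memNset ?mulr0 ?addr0//.
by apply; exists i.
Qed.

Lemma conic_adjoint_others (w : 'rV[R]_(m + 1 + 1)) (x y : T) :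
  others xi y ->
  conic_adjoint (psi_constr xi d) w (x, y) = w ord0 (lshift 1 (rshift m ord0)).
Proof.
move=> oy; have indic0 i : \1_[set xi i] y = 0 :> R.
  by rewrite indicE memNset// => yi; apply: oy; exists i.
rewrite conic_adjointE /psi_cost/= !big1 => [|i _|i _]; last 2 first.
- by rewrite indic0 mulr0.
- by rewrite indic0 mulr0.
by rewrite indicE mem_set// mulr1 mulr0 addr0 add0r.
Qed.

Lemma integrable_all_bounded {dO : measure_display} {O : measurableType dO}
    (f : O -> R) (M : R) :
  measurable_fun [set: O] f -> (forall s, `|f s| <= M) -> integrable_all f.
Proof.
move=> mf fM mu; apply: measurable_bounded_integrable => //.
  by rewrite -ge0_fin_numE// fin_num_measure.
exists M; split; first exact: num_real.
by move=> x Mx s _; exact: le_trans (fM s) (ltW Mx).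
Qed.

(** The adjoint is a finite combination of bounded indicators and the cost; this gives the
    membership in X' that [neg_polar] demands. *)
Lemma conic_adjoint_integrable (w : 'rV[R]_(m + 1 + 1)) :
  integrable_all (psi_cost xi d) ->
  integrable_all (conic_adjoint (psi_constr xi d) w).
Proof.
move=> cost_int mu.
have int_indic (B : set T) : measurable B ->
    integrable_all (fun s : T * T => \1_B s.2 : R).
  move=> mB; apply: (@integrable_all_bounded _ _ _ 1) => [|s].
    by apply: (measurableT_comp (measurable_indic mB)); exact: measurable_snd.
  by rewrite indicE normr_nat lern1 leq_b1.
rewrite (_ : EFin \o _ = fun s => (\sum_(j < m + 1 + 1)
    (w ord0 j)%:E * (psi_constr xi d j s)%:E)%E); last first.
  by apply/funext => s; rewrite /= /conic_adjoint -sumEFin.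
apply: integrable_sum => // j _; apply: integrableZl => //.
rewrite /psi_constr; case: fintype.split => [k|_]; last exact: cost_int.
apply: int_indic; rewrite /cell; case: fintype.split => // _.
exact: measurable_others.
Qed.

Lemma pairing_dirac {dO : measure_display} {O : measurableType dO}
    (f : O -> R) (a : O) :
  measurable_fun [set: O] f -> pairing \d_a f = f a.
Proof.
move=> mf; rewrite /pairing /Rintegral integral_dirac//; last exact/measurable_EFinP.
by rewrite diracT mul1e.
Qed.

(* The unconstrained multiplier of the cell [others] is set to [- M], so that the
   dual constraint holds there for free. *)
Lemma conic_dualE (M : R) :
  measurable_fun [set: T] hth -> (forall s, `|hth s| <= M) ->
  integrable_all (psi_cost xi d) ->
  @CLPD_of_dual R m @`
    conic_dual_feasible (psi_obj hth) (psi_constr xi d) (@constr_cone R m)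
  = CLPD_feasible xi d hth.
Proof.
move=> mh hM cost_int; apply/seteqP; split.
  move=> _ [w [[f_int f_le0] /dual_coneE w0] <-]; split; last first.
    by rewrite /CLPD_of_dual row_mxEr mxE oppr_ge0.
  move=> x i; rewrite /CLPD_of_dual row_mxEl row_mxEr !mxE.
  have := f_le0 \d_(x, xi i); rewrite pairing_dirac; last first.
    by have /measurable_int/measurable_EFinP := f_int \d_(x, xi i).
  rewrite conic_adjoint_sample /psi_obj/=; lra.
move=> v [hv l0].
pose w : 'rV[R]_(m + 1 + 1) :=
  row_mx (row_mx (\row_i - v ord0 (lshift 1 i)) (const_mx (- M)))
         (const_mx (- v ord0 (rshift m ord0))).
exists w; last first.
  apply/rowP => j; rewrite /CLPD_of_dual /w; case: (split_ordP j) => k ->.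
    by rewrite row_mxEl mxE !row_mxEl mxE opprK.
  by rewrite (ord1 k) row_mxEr mxE row_mxEr mxE opprK.
split; last by apply/dual_coneE; rewrite /w row_mxEr mxE oppr_le0.
have f_int : integrable_all (fun x => conic_adjoint (psi_constr xi d) w x + psi_obj hth x).
  have obj_int : integrable_all (psi_obj hth : T * T -> R).
    apply: (@integrable_all_bounded _ _ _ M) => [|s]; last exact: hM.
    by apply: (measurableT_comp mh); exact: measurable_fst.
  move=> mu.
  have adj_int := conic_adjoint_integrable w cost_int.
  rewrite (_ : EFin \o _ =
    (EFin \o conic_adjoint (psi_constr xi d) w) \+ (EFin \o psi_obj hth))%E//.
  by apply: integrableD => //; [exact: adj_int|exact: obj_int].
split => // mu; rewrite /pairing /Rintegral fine_le0//.
rewrite -(integral0 mu [set: _]); apply: le_integral => //.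
- exact: f_int.
- exact: integrable0.
move=> [x y] _; rewrite lee_fin.
(* Over a sample the sign is the constraint of (CLP-D); over [others] it reads [h - M <= 0]. *)
have [[i _ <-]|oy] := pselect (range xi y).
  rewrite conic_adjoint_sample /w row_mxEl row_mxEl row_mxEr !mxE /psi_obj/=.
  by have := hv x i; lra.
rewrite conic_adjoint_others// /w row_mxEl row_mxEr mxE /psi_obj/= addrC subr_le0.
exact: le_trans (ler_norm _) (hM x).
Qed.

End ConicDual.

Theorem theorem3p7 (R : realType) (n m : nat)
    (dT : measure_display) (T : measurableType dT)
    (Xi : set 'rV[R]_n) (emb : T -> 'rV[R]_n)
    (emb_bij : set_bij [set: T] Xi emb)
    (measurable_singleton : forall s : T, measurable [set s])
    (d : T -> T -> R) (d_metric : is_metric d)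
    (d_meas : measurable_fun [set: (T * T)%type] (fun s : T * T => d s.1 s.2))
    (m_gt0 : (0 < m)%N) (xi : 'I_m -> T) (xi_inj : injective xi)
    (r0 : R) (r0_gt0 : 0 < r0)
    (Theta : set 'rV[R]_n) (Theta_compact : compact Theta)
    (Xi_compact : compact Xi)
    (h : 'rV[R]_n -> T -> R)
    (h_cont : forall s : T, {within Theta, continuous (fun th => h th s)})
    (h_bounded : exists M : R, forall th s, Theta th -> `|h th s| <= M)
    (h_lipschitz : forall th, Theta th -> exists2 C : R, 0 < C &
       forall s1 s2 : T, `|h th s1 - h th s2| <= C * d s1 s2)
    (theta : 'rV[R]_n) (theta_in : Theta theta)
    (h_meas : measurable_fun [set: T] (h theta)) :
  [/\ (* the conic dual of (CLP) is (CLP-D), via the change of variables; the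
         premise says that the conic data of (CLP) lie in X' *)
      integrable_all (psi_cost xi d) ->
      @CLPD_of_dual R m @`
        conic_dual_feasible (psi_obj (h theta)) (psi_constr xi d)
          (@constr_cone R m)
      = CLPD_feasible xi d (h theta),
      forall w : 'rV[R]_(m + 1 + 1),
        conic_dual_objective (rhs m r0) w = CLPD_objective r0 (CLPD_of_dual w),
      (* strong duality, the minimum in (CLP-D) being attained *)
      exists v, CLPD_optimal xi d r0 (h theta) v,
      CLP_value xi d r0 (h theta) = CLPD_value xi d r0 (h theta)
    & (* localization of the optimal solutions *)
      forall C1 C2 : R,
        (forall th s, Theta th -> C1 <= h th s <= C2) ->
        CLPD_optimal xi d r0 (h theta) `<=` @polytope_H R m r0 C1 C2].
Proof.
have [M hM] := h_bounded.
have hMt s : `|h theta s| <= M by exact: hM.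
have [opt strong] := CLP_strong_duality measurable_singleton d_metric d_meas
  m_gt0 xi_inj r0_gt0 h_meas hMt.
split => //.
- exact: conic_dualE hMt.
- exact: conic_dual_objectiveE.
- move=> C1 C2 hC; apply: CLPD_optimal_in_polytope => // s.
  exact: hC.
Qed.
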